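(* Let $f:\mathbb{R}^d\to\mathbb{R}$ be $L$-coordinate-Lipschitz with constants $L_1,\dots,L_d>0$, i.e. for all $i\in[d]$, $x\in\mathbb{R}^d$, $h\in\mathbb{R}$: $|\nabla_i f(x+h\mathbf{e}_i)-\nabla_i f(x)|\le L_i|h|$. Let $\alpha\ge 0$, let $x^*$ be a minimizer of $f$, and let $x_0,x_1,\dots$ be the iterates of the algorithm OrderRCD (described in the context), run with the Order Oracle with noise level $\Delta$ and with line-search accuracy $\epsilon$. Let $F_0=f(x_0)-f(x^* )$ and $\Phi=\frac{1+\sqrt5}{2}$. Then there is a constant $C$, depending only on the constant $c$ of the line-search guarantee, such that for every number of iterations $N\ge1$ $$\frac1N\sum_{k=0}^{N-1}\mathbb{E}\Big[\big(\|\nabla f(x_k)\|_{[1-\alpha]}^*\big)^2\Big]\le C\left(\frac{S_\alpha F_0}{N}+S_\alpha\,\epsilon+S_\alpha\,\Phi\,\Delta\right).$$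
   Context: Notation: $[d]=\{1,\dots,d\}$; $\mathbf{e}_i$ is the $i$-th unit vector of $\mathbb{R}^d$; $\nabla_i f$ is the $i$-th partial derivative of the differentiable function $f$. For real $s$: $S_s=\sum_{i=1}^d L_i^s$, $\|x\|_{[s]}=\sqrt{\sum_{i=1}^d L_i^s x_i^2}$ and $\|x\|_{[s]}^*=\sqrt{\sum_{i=1}^d L_i^{-s}x_i^2}$. Order Oracle: the function $f$ is accessed only through $\phi(x,y)=\mathrm{sign}[f(x)-f(y)+\delta(x,y)]$, where the noise satisfies $|\delta(x,y)|\le\Delta$, $\Delta\ge 0$. Algorithm OrderRCD (random coordinate descent with order oracle): given $x_0\in\mathbb{R}^d$, at each iteration $k=0,1,\dots$: (1) draw, independently of the past, a coordinate $i_k\in[d]$ with probabilities $p_\alpha(i)=L_i^\alpha/S_\alpha$; (2) compute $\eta_k\approx\mathrm{argmin}_{\eta\in\mathbb{R}}f(x_k+\eta\mathbf{e}_{i_k})$ by a line search (the golden ratio method) that uses only the Order Oracle; (3) set $x_{k+1}=x_k+\eta_k\mathbf{e}_{i_k}$. Line-search guarantee (standing convention): the computed $\eta_k$ satisfies $f(x_k+\eta_k\mathbf{e}_{i_k})\le f(x_k+\eta\mathbf{e}_{i_k})+\epsilon+c\,\Phi\,\Delta$ for all $\eta\in\mathbb{R}$, where $\epsilon\ge0$ is the accuracy (in function value) of the line search, $\Phi=\frac{1+\sqrt5}{2}$, and $c$ is a constant. $\mathbb{E}$ is the expectation over the random choice of coordinates. *)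

(* Defs.v *)
From HB Require Import structures.
From mathcomp Require Import all_boot all_order all_algebra.
From mathcomp Require Import all_classical all_reals all_analysis.

Set Implicit Arguments.
Unset Strict Implicit.
Unset Printing Implicit Defensive.

Import Order.TTheory GRing.Theory Num.Theory.
Import numFieldNormedType.Exports.

Local Open Scope classical_set_scope.
Local Open Scope ring_scope.

Section Geometry.
Context {R : realType} {d : nat}.
Implicit Types (L : 'I_d -> R) (s : R) (x : 'rV[R]_d) (f : 'rV[R]_d -> R).

Definition unit_vec (i : 'I_d) : 'rV[R]_d := delta_mx 0 i.

Definition partial f (i : 'I_d) x : R := 'D_(unit_vec i) f x.

Definition grad f x : 'rV[R]_d := \row_i partial f i x.

Definition coord_lipschitz L f : Prop :=
  forall (i : 'I_d) x (h : R),
    `|partial f i (x + h *: unit_vec i) - partial f i x| <= L i * `|h|.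

Definition S_ L s : R := \sum_(i < d) L i `^ s.

Definition dual_norm L s x : R :=
  Num.sqrt (\sum_(i < d) L i `^ (- s) * x 0 i ^+ 2).

Definition coord_prob L (alpha : R) (i : 'I_d) : R := L i `^ alpha / S_ L alpha.

End Geometry.

Definition golden_ratio (R : realType) : R := (1 + Num.sqrt 5) / 2.

Section Algorithm.
Context {R : realType} {d : nat}.
Local Notation V := 'rV[R]_d.

Definition order_oracle (f : V -> R) (delta : V -> V -> R) (x y : V) : R :=
  Num.sg (f x - f y + delta x y).

(* A line search receives the comparison oracle, never f itself; it may change
   from one iteration to the next (e.g. its initial bracket or its number of
   oracle calls), whence the iteration number. It returns the step size. *)
Definition line_search : Type := nat -> (V -> V -> R) -> V -> 'I_d -> R.

Definition step (search : line_search) (phi : V -> V -> R)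
    (k : nat) (x : V) (i : 'I_d) : V :=
  x + search k phi x i *: unit_vec i.

Fixpoint OrderRCD (search : line_search) (phi : V -> V -> R) (x0 : V)
    (i : nat -> 'I_d) (k : nat) : V :=
  if k is k'.+1 then
    step search phi k' (OrderRCD search phi x0 i k') (i k')
  else x0.

End Algorithm.

(* The family [i] is a sequence of random coordinates of law [p], each drawn
   independently of the earlier ones. As coordinates are finitely many, it is
   enough to consider the atoms {i_0 = s_0, ..., i_(k-1) = s_(k-1)} of the
   past. *)
Definition independent_draws {dT : measure_display} {T : measurableType dT}
    {R : realType} {d : nat} (P : probability T R) (p : 'I_d -> R)
    (i : nat -> T -> 'I_d) : Prop :=
  [/\ forall k j, measurable [set w | i k w = j],
      forall k j, P [set w | i k w = j] = (p j)%:E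
    & forall k j (s : nat -> 'I_d),
        let past := [set w | forall l, (l < k)%N -> i l w = s l] in
        P ([set w | i k w = j] `&` past) = (P [set w | i k w = j] * P past)%E].

(* Main.v *)
Require Import Defs.
From HB Require Import structures.
From mathcomp Require Import all_boot all_order all_algebra.
From mathcomp Require Import all_classical all_reals all_analysis.
From mathcomp Require Import measurable_realfun ring lra.
Import Order.TTheory GRing.Theory Num.Theory.
Import numFieldNormedType.Exports.
Local Open Scope classical_set_scope.
Local Open Scope ring_scope.

(** Fix a coordinate [j] and a point [x], and write [g] for the partial
    derivative of [f] at [x]. Since the partial derivative is [L j]-Lipschitz
    along the [j]-th axis, moving by [t = - g / (2 L j)] decreases [f] by at
    least [g ^+ 2 / (4 L j)] ([coordinate_descent]). The line search does at
    least as well as this explicit step, up to the error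
    [E = epsilon + c Phi Delta], so along every realization of the draws
    [g ^+ 2 / L j], taken at the [k]-th iterate for the coordinate drawn there,
    is at most [4 (f x_k - f x_(k+1) + E)]. These bounds telescope, and [f] is
    bounded below by [f xstar]: the sum over [k < N] is at most
    [4 (F0 + N E)] ([sum_scaled_sq_partial]).

    The squared dual norm of the gradient is [S_ L alpha] times the average of
    [g ^+ 2 / L j] over a coordinate [j] of law [coord_prob L alpha]
    ([dual_norm_grad_sq]): the exponent [1 - alpha] of the norm is what the
    sampling weights [L j `^ alpha] and the descent constants [1 / L j]
    produce together. As the [k]-th iterate depends only on
    the earlier draws, of which the [k]-th draw is independent, the expectation
    of that average is the expectation of the value at the coordinate actually
    drawn ([expectation_draw]). Integrating the pathwise bound therefore gives
    the theorem, with [C = 4 max(1, c)].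

    Everything that is integrated is a nonnegative function of finitely many
    draws, hence takes finitely many values; averaging over a draw is thus an
    identity between finite sums. As the telescoping takes place before
    integration, the values of [f] themselves are never integrated. *)

(** * Descent along a coordinate *)

(** The mean value theorem for [f] restricted to the segment from [x] to
    [x + v]. Parametrizing the segment by [0 <= s <= 1], instead of a line by a
    signed step length, avoids distinguishing the sign of the step. *)
Lemma mean_value_line (R : realType) (d : nat) (f : 'rV[R]_d -> R)
    (x v : 'rV[R]_d) :
  (forall y, differentiable f y) ->
  exists2 s : R, 0 <= s <= 1 & f (x + v) - f x = 'D_v f (x + s *: v).
Proof.
move=> df.
have dline (s : R) :
    is_derive s 1 (fun s : R => f (x + s *: v)) ('D_v f (x + s *: v)).
  have dl : is_diff s (fun s : R => x + s *: v) (0 + *:%R^~ v).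
    exact: (@is_diffD _ _ _ (cst x) (fun s : R => s *: v)).
  have dfl : differentiable (fun s : R => x + s *: v) s by case: dl.
  have dc : differentiable (f \o (fun s : R => x + s *: v)) s.
    by apply: differentiable_comp.
  apply: DeriveDef; first by apply/derivable1_diffP.
  rewrite (deriveE _ dc) diff_comp// diff_val /= (deriveE _ (df _)).
  by rewrite add0r scale1r.
have cline : {within `[0, 1], continuous (fun s : R => f (x + s *: v))}.
  apply: continuous_subspaceT => s; apply/differentiable_continuous.
  by apply/derivable1_diffP; case: (dline s).
have [s sI] := MVT_segment ler01 (fun s _ => dline s) cline.
rewrite scale1r scale0r addr0 subr0 mulr1 => eqf; exists s => //.
Qed.

(** By the mean value theorem the increment is [t * g'], where [g'] is the
    partial derivative at an intermediate point, so that [`|g' - g| <= L j * `|t|].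
    Hence the increment is at most [t * g + L j * t ^+ 2], and the step below
    minimizes this bound. (Integrating the derivative instead would replace
    the constant [4] by [2].) *)
Lemma coordinate_descent (R : realType) (d : nat) (L : 'I_d -> R)
    (f : 'rV[R]_d -> R) (x : 'rV[R]_d) (j : 'I_d) :
  0 < L j -> (forall y, differentiable f y) -> coord_lipschitz L f ->
  exists t : R, f (x + t *: unit_vec j) + partial f j x ^+ 2 / (4 * L j) <= f x.
Proof.
move=> Lj df Lf; set g := partial f j x.
exists (- (g / (2 * L j))); set t := - _.
have [s /andP[s0 s1]] := mean_value_line _ _ _ x (t *: unit_vec j) df.
rewrite (deriveE _ (df _)) linearZ /= -(deriveE _ (df _)) scalerA.
rewrite -/(partial f j _) => eqf.
have lip : `|partial f j (x + (s * t) *: unit_vec j) - g| <= L j * `|t|.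
  apply: (le_trans (Lf _ _ _)); rewrite normrM (ger0_norm s0).
  by rewrite ler_pM2l// ler_piMl.
set g' := partial f j _ in eqf lip.
have tg : t * g = - (g ^+ 2 / (2 * L j)) by rewrite /t; field; rewrite gt_eqF.
have tt : L j * t ^+ 2 = g ^+ 2 / (4 * L j) by rewrite /t; field; rewrite gt_eqF.
have g4 : g ^+ 2 / (2 * L j) = 2 * (g ^+ 2 / (4 * L j)) by field; rewrite gt_eqF.
have cross : t * (g' - g) <= L j * t ^+ 2.
  apply: (le_trans (ler_norm _)); rewrite normrM -(real_normK (num_real t)).
  by rewrite expr2 mulrCA ler_wpM2l.
move: eqf; rewrite (_ : t *: _ = t * g')// => eqf.
rewrite mulrBr tg tt g4 in cross.
lra.
Qed.

(** * Averaging over an independent draw *)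

Section FiniteValued.
Context {dT : measure_display} {T : measurableType dT} {R : realType}.
Variables (P : probability T R) (I : finType) (Y : T -> I).
Hypothesis mY : forall y, measurable [set w | Y w = y].

Lemma measurable_finite_valued (g : I -> R) :
  measurable_fun setT (fun w => g (Y w)).
Proof.
move=> _ B mB; rewrite setTI.
have -> : (fun w => g (Y w)) @^-1` B
    = \bigcup_(y in [set y | B (g y)]) [set w | Y w = y].
  apply/seteqP; split=> [w Bw|w [y By /= Yw]]; first by exists (Y w).
  by rewrite /preimage /= Yw.
exact: fin_bigcup_measurable.
Qed.

Lemma expectation_finite_valued (g : I -> R) : (forall y, 0 <= g y) ->
  ('E_P[fun w => g (Y w)] =
    (\sum_y g y * fine (P [set w | Y w = y]))%R%:E)%E.
Proof.
move=> g0; rewrite unlock.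
under eq_integral => w _.
  rewrite (_ : (g (Y w))%:E =
      (\sum_y (g y)%:E * (\1_[set w | Y w = y] w)%:E)%E); last first.
    rewrite (bigD1 (Y w))//= indicE mem_set// mule1 big1 ?adde0// => y yY.
    by rewrite indicE memNset ?mule0// => /= Yy; move: yY; rewrite Yy eqxx.
  over.
rewrite ge0_integral_sum//; last 2 first.
- move=> y; apply: measurable_funeM; apply/measurable_EFinP.
  exact: measurable_indic.
- by move=> y w _; rewrite mule_ge0// lee_fin.
rewrite -sumEFin; apply: eq_bigr => y _.
rewrite ge0_integralZl_EFin//; last first.
  by apply/measurable_EFinP; exact: measurable_indic.
by rewrite integral_indic// setIT EFinM fineK// fin_num_measure.
Qed.

End FiniteValued.

Section Draws.
Context {dT : measure_display} {T : measurableType dT} {R : realType} {d : nat}.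
Variables (P : probability T R) (p : 'I_d -> R) (i : nat -> T -> 'I_d).
Hypothesis indep : independent_draws P p i.

Definition past (k : nat) (w : T) : {ffun 'I_k -> 'I_d} :=
  [ffun l : 'I_k => i l w].

(** The algorithm and the independence hypothesis speak of infinite sequences of
    coordinates, whereas finite sums need a finite type of histories: this leads
    back from the latter to the former. The default coordinate [j0] is never
    read, because only the first [k] terms matter. *)
Definition extend (j0 : 'I_d) {k : nat} (s : {ffun 'I_k -> 'I_d}) (l : nat)
    : 'I_d :=
  if insub l is Some l' then s l' else j0.

Lemma extend_past (j0 : 'I_d) k w l : (l < k)%N ->
  extend j0 (past k w) l = i l w.
Proof. by move=> lk; rewrite /extend insubT ffunE. Qed.

Lemma past_event (j0 : 'I_d) k (s : {ffun 'I_k -> 'I_d}) :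
  [set w | past k w = s] =
    [set w | forall l, (l < k)%N -> i l w = extend j0 s l].
Proof.
apply/seteqP; split=> [w /= <- l lk|w /= H]; first by rewrite extend_past.
by apply/ffunP => l; rewrite ffunE H// /extend valK.
Qed.

Lemma measurable_past k (s : {ffun 'I_k -> 'I_d}) :
  measurable [set w | past k w = s].
Proof.
case: indep => mi _ _.
have -> : [set w | past k w = s] =
    \bigcap_(l in [set: 'I_k]) [set w | i l w = s l].
  apply/seteqP; split=> [w /= <- l _|w /= H]; first by rewrite /= ffunE.
  by apply/ffunP => l; rewrite ffunE; exact: H.
by apply: fin_bigcap_measurable.
Qed.

Let draw_event k (y : {ffun 'I_k -> 'I_d} * 'I_d) :
  [set w | (past k w, i k w) = y] =
    [set w | i k w = y.2] `&` [set w | past k w = y.1].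
Proof. by case: y => s j; apply/seteqP; split=> [w [<- <-]|w [/= <- <-]]. Qed.

Let measurable_draw k (y : {ffun 'I_k -> 'I_d} * 'I_d) :
  measurable [set w | (past k w, i k w) = y].
Proof.
rewrite draw_event; apply: measurableI; last exact: measurable_past.
by case: indep.
Qed.

Definition history_dependent (k : nat) (g : (nat -> 'I_d) -> 'I_d -> R) :=
  forall s s' j, (forall l, (l < k)%N -> s l = s' l) -> g s j = g s' j.

Lemma history_dependentE {k g} (w0 : T) : history_dependent k g ->
  forall w j, g (i^~ w) j = g (extend (i 0%N w0) (past k w)) j.
Proof. by move=> gk w j; apply: gk => l lk; rewrite extend_past. Qed.

Lemma measurable_draw_fun k g : history_dependent k g ->
  measurable_fun setT (fun w => g (i^~ w) (i k w)).
Proof.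
move=> gk.
have [/eqP T0|/set0P[w0 _]] := boolP ([set: T] == set0).
  by rewrite T0; exact: measurable_fun_set0.
under eq_fun do rewrite (history_dependentE w0 gk).
exact: (measurable_finite_valued _ _ (measurable_draw k)
  (fun y => g (extend (i 0%N w0) y.1) y.2)).
Qed.

(** Conditionally on the draws before it, the [k]-th draw has law [p]. In terms
    of finite sums: the event that the history is [s] and the [k]-th draw is [j]
    has probability [p j] times that of the history [s], so that both sides are the
    same sum over pairs [(s, j)]. *)
Lemma expectation_draw k g : history_dependent k g ->
  (forall s j, 0 <= g s j) ->
  ('E_P[fun w => g (i^~ w) (i k w)]
    = 'E_P[fun w => (\sum_j p j * g (i^~ w) j)%R])%E.
Proof.
move=> gk g0; case: (indep) => mi Pi Pind.
have p0 j : 0 <= p j by rewrite -lee_fin -(Pi 0%N).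
have [/eqP T0|/set0P[w0 _]] := boolP ([set: T] == set0).
  have := probability_setT P; rewrite T0 measure0 => /eqP.
  by rewrite eqe eq_sym oner_eq0.
set e := @extend (i 0%N w0) k.
have -> : (fun w => g (i^~ w) (i k w)) =
    (fun w => g (e (past k w)) (i k w)).
  by apply/funext => w; rewrite (history_dependentE w0 gk).
have -> : (fun w => \sum_j p j * g (i^~ w) j) =
    (fun w => \sum_j p j * g (e (past k w)) j).
  apply/funext => w; apply: eq_bigr => j _.
  by rewrite (history_dependentE w0 gk).
rewrite (expectation_finite_valued P _ _ (measurable_draw k)
  (fun y => g (e y.1) y.2))//.
rewrite (expectation_finite_valued P _ _ (@measurable_past k)
  (fun s => \sum_j p j * g (e s) j)); last first.
  by move=> s; apply: sumr_ge0 => j _; rewrite mulr_ge0.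
congr EFin.
under [RHS]eq_bigr do rewrite mulr_suml.
rewrite pair_bigA; apply: eq_bigr => -[s j] _ /=.
rewrite draw_event /= (past_event (i 0%N w0)) Pind Pi fineM//; last first.
  by rewrite -past_event fin_num_measure//; exact: measurable_past.
by rewrite /= mulrCA mulrA.
Qed.

End Draws.

(** * Iterates of the algorithm *)

Section Iterates.
Context {R : realType} {d : nat}.
Variables (L : 'I_d -> R) (f : 'rV[R]_d -> R) (search : @line_search R d)
  (phi : 'rV[R]_d -> 'rV[R]_d -> R) (x0 : 'rV[R]_d).

Lemma OrderRCD_past (k : nat) (s s' : nat -> 'I_d) :
  (forall l, (l < k)%N -> s l = s' l) ->
  OrderRCD search phi x0 s k = OrderRCD search phi x0 s' k.
Proof.
elim: k => //= k IH ss'; rewrite ss'// IH// => l lk; apply: ss'.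
exact: ltnW.
Qed.

(** Up to a factor [4], the decrease of [f] that the coordinate [j] guarantees
    at the [k]-th iterate. As a function of the whole sequence of draws and of a
    coordinate, it can be evaluated both at the drawn coordinate and at all
    coordinates in turn. *)
Definition scaled_sq_partial (k : nat) (s : nat -> 'I_d) (j : 'I_d) : R :=
  partial f j (OrderRCD search phi x0 s k) ^+ 2 / L j.

Hypotheses (L_gt0 : forall j, 0 < L j) (df : forall y, differentiable f y)
  (Lf : coord_lipschitz L f).

(** Each term is bounded by comparing the line search with the step of
    [coordinate_descent], and the decreases of [f] telescope. *)
Lemma sum_scaled_sq_partial (E : R) (s : nat -> 'I_d) :
  (forall k (t : R), let x := OrderRCD search phi x0 s k in
     f (OrderRCD search phi x0 s k.+1) <= f (x + t *: unit_vec (s k)) + E) ->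
  forall N, \sum_(0 <= k < N) scaled_sq_partial k s (s k)
    <= 4 * (f x0 - f (OrderRCD search phi x0 s N) + N%:R * E).
Proof.
move=> ls; elim=> [|N IH]; first by rewrite big_geq//= subrr mul0r addr0 mulr0.
rewrite big_nat_recr//=; set x := OrderRCD search phi x0 s N in IH *.
have [t ft] := coordinate_descent _ _ L f x (s N) (L_gt0 _) df Lf.
have {}ls := ls N t; rewrite /= -/x in ls.
have gE : scaled_sq_partial N s (s N) =
    4 * (partial f (s N) x ^+ 2 / (4 * L (s N))).
  by rewrite /scaled_sq_partial -/x; field; rewrite gt_eqF.
rewrite gE; set q := partial _ _ _ ^+ 2 / _ in ft *.
rewrite -natr1; lra.
Qed.

(** The choice of the norm is dictated by this identity: the weight
    [L j `^ (alpha - 1)] is, up to [S_ L alpha], the sampling probability of [j]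
    divided by [L j]. *)
Lemma dual_norm_grad_sq (alpha : R) (x : 'rV[R]_d) : 0 < S_ L alpha ->
  dual_norm L (1 - alpha) (grad f x) ^+ 2
    = S_ L alpha * \sum_j coord_prob L alpha j * (partial f j x ^+ 2 / L j).
Proof.
move=> S0; rewrite /dual_norm sqr_sqrtr; last first.
  by apply: sumr_ge0 => j _; rewrite mulr_ge0 ?sqr_ge0 ?powR_ge0.
rewrite mulr_sumr; apply: eq_bigr => j _.
rewrite mxE opprB powRD; last by rewrite (gt_eqF (L_gt0 j)) implybT.
rewrite powR_inv1 ?ltW// /coord_prob; field.
by rewrite !gt_eqF.
Qed.

End Iterates.

Theorem theorem3p1 (R : realType) (c : R) :
  exists C : R,
  forall (d : nat) (L : 'I_d -> R) (f : 'rV[R]_d -> R) (alpha : R)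
    (xstar x0 : 'rV[R]_d)
    (Delta epsilon : R) (delta : 'rV[R]_d -> 'rV[R]_d -> R)
    (search : @line_search R d)
    (dT : measure_display) (T : measurableType dT) (P : probability T R)
    (i : nat -> T -> 'I_d),
  let x (k : nat) (w : T) : 'rV[R]_d :=
    OrderRCD search (order_oracle f delta) x0 (fun l => i l w) k in
  let eta (k : nat) (w : T) : R :=
    search k (order_oracle f delta) (x k w) (i k w) in
  let F0 : R := f x0 - f xstar in
  let Phi : R := golden_ratio R in
  (forall j, 0 < L j) ->
  (forall y, differentiable f y) ->
  coord_lipschitz L f ->
  0 <= alpha ->
  (forall y, f xstar <= f y) ->
  0 <= Delta ->
  (forall y z, `|delta y z| <= Delta) ->
  0 <= epsilon ->
  independent_draws P (coord_prob L alpha) i ->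
  (forall k w (t : R),
     f (x k w + eta k w *: unit_vec (i k w))
       <= f (x k w + t *: unit_vec (i k w)) + epsilon + c * Phi * Delta) ->
  forall N : nat, (1 <= N)%N ->
  (((N%:R^-1)%R)%:E *
     \sum_(0 <= k < N)
       'E_P[fun w => (dual_norm L (1 - alpha) (grad f (x k w)) ^+ 2)%R]
   <= ((C * (S_ L alpha * F0 / N%:R + S_ L alpha * epsilon
            + S_ L alpha * Phi * Delta))%R)%:E)%E.
Proof.
exists (4 * Num.max 1 c).
move=> d L f alpha xstar x0 Delta eps delta search dT T P i x eta F0 Phi.
move=> L0 df Lf _ fmin Delta0 _ eps0 indep ls N N1.
have [/eqP T0|/set0P[w0 _]] := boolP ([set: T] == set0).
  have := probability_setT P; rewrite T0 measure0 => /eqP.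
  by rewrite eqe eq_sym oner_eq0.
have S0 : 0 < S_ L alpha.
  rewrite /S_ (bigD1 (i 0%N w0))//= ltr_pwDl ?powR_gt0//.
  by apply: sumr_ge0 => j _; rewrite powR_ge0.
set S := S_ L alpha in S0 *.
pose E := eps + c * Phi * Delta.
pose g := scaled_sq_partial L f search (order_oracle f delta) x0.
have g0 k s j : 0 <= g k s j by rewrite divr_ge0 ?sqr_ge0// ltW.
have gpast k : history_dependent k (g k).
  move=> s s' j ss'; rewrite /g /scaled_sq_partial.
  by rewrite (OrderRCD_past _ _ _ _ _ _ ss').
have mg k : measurable_fun setT (fun w => g k (i^~ w) (i k w)).
  exact: (measurable_draw_fun _ _ _ indep _ _ (gpast k)).
have EgradE k :
    ('E_P[fun w => (dual_norm L (1 - alpha) (grad f (x k w)) ^+ 2)%R]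
     = \int[P]_w (S * g k (i^~ w) (i k w))%:E)%E.
  have Sgpast : history_dependent k (fun s j => S * g k s j).
    by move=> s s' j ss'; rewrite (gpast k _ _ _ ss').
  transitivity ('E_P[fun w => (S * g k (i^~ w) (i k w))%R])%E; last first.
    by rewrite unlock.
  rewrite (expectation_draw P _ _ indep _ _ Sgpast); last first.
    by move=> s j; rewrite mulr_ge0// ltW.
  congr expectation; apply/funext => w; rewrite dual_norm_grad_sq// mulr_sumr.
  by apply: eq_bigr => j _; rewrite mulrCA.
have path w :
    \sum_(0 <= k < N) S * g k (i^~ w) (i k w) <= S * (4 * (F0 + N%:R * E)).
  rewrite -mulr_sumr ler_pM2l//.
  have lsw k (t : R) :
      f (x k.+1 w) <= f (x k w + t *: unit_vec (i k w)) + E.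
    by rewrite /E addrA; exact: ls.
  have := sum_scaled_sq_partial L f search _ x0 L0 df Lf E (i^~ w) lsw N.
  move=> /le_trans; apply; rewrite ler_pM2l// lerD2r lerD2l lerN2.
  exact: fmin.
have Phi0 : 0 <= Phi by rewrite divr_ge0// addr_ge0// sqrtr_ge0.
have sumE : (\sum_(0 <= k < N)
       'E_P[fun w => (dual_norm L (1 - alpha) (grad f (x k w)) ^+ 2)%R]
   <= (S * (4 * (F0 + N%:R * E)))%:E)%E.
  under eq_bigr do rewrite EgradE.
  rewrite -ge0_integral_sum//; last 2 first.
  - by move=> k; apply/measurable_EFinP; exact: measurable_funM.
  - by move=> k w _; rewrite lee_fin mulr_ge0// ltW.
  under eq_integral do rewrite sumEFin.
  rewrite -[leRHS]mule1 -(probability_setT P) -integral_cst//.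
  apply: ge0_le_integral => //.
  - by move=> w _; rewrite lee_fin sumr_ge0// => k _; rewrite mulr_ge0// ltW.
  - apply/measurable_EFinP; apply: measurable_sum => k.
    exact: measurable_funM.
  - by move=> w _; rewrite lee_fin.
have N0 : 0 < N%:R :> R by rewrite ltr0n.
apply: (@le_trans _ _ (N%:R^-1%:E * (S * (4 * (F0 + N%:R * E)))%:E)%E).
  by rewrite lee_pmul2l// ?lte_fin ?invr_gt0.
rewrite -EFinM lee_fin.
(* The bound is written with the coefficients 1, 1 and c in front of its three
   nonnegative terms, each coefficient being at most max(1, c). *)
have -> : N%:R^-1 * (S * (4 * (F0 + N%:R * E)))
    = 4 * (1 * (S * F0 / N%:R) + 1 * (S * eps) + c * (S * Phi * Delta)).
  by rewrite /E; field; rewrite gt_eqF.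
have F00 : 0 <= F0 by rewrite subr_ge0.
(* F0 is made opaque so that it is not expanded by distributivity. *)
clearbody F0; rewrite -[leRHS]mulrA ler_pM2l// !mulrDr.
rewrite lerD ?lerD// ler_wpM2r ?le_max ?lexx ?orbT//.
- by rewrite divr_ge0// mulr_ge0// ltW.
- by rewrite mulr_ge0// ltW.
- by rewrite !mulr_ge0// ltW.
Qed.
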